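(* Let $G$ be a subgroup of $\mathcal{S}_3$ and let $(V,\mu,\alpha)$ be a finite-dimensional $G$-Hom-associative algebra over $\mathbb{K}$. Then the dual vector space $V^\star$ carries a $G$-Hom-coalgebra structure $(V^\star,\mu^\star,\alpha^\star)$, where $\mu^\star$ and $\alpha^\star$ are the transpose maps.
   Context: $\mathbb{K}$ is an algebraically closed field of characteristic $0$. For a vector space $W$ and $\sigma\in\mathcal{S}_3$ (the symmetric group), $\Phi_\sigma:W^{\otimes 3}\to W^{\otimes 3}$ is the linear map $\Phi_\sigma(x_1\otimes x_2\otimes x_3)=x_{\sigma^{-1}(1)}\otimes x_{\sigma^{-1}(2)}\otimes x_{\sigma^{-1}(3)}$, and $(-1)^{\epsilon(\sigma)}$ is the signature of $\sigma$. For a subgroup $G\le\mathcal{S}_3$, a $G$-Hom-associative algebra is a triple $(V,\mu,\alpha)$ with $V$ a $\mathbb{K}$-vector space and $\mu:V\otimes V\to V$, $\alpha:V\to V$ linear maps such that $\sum_{\sigma\in G}(-1)^{\epsilon(\sigma)}a_{\alpha,\mu}\circ\Phi_\sigma=0$, where $a_{\alpha,\mu}=\mu\circ(\mu\otimes\alpha)-\mu\circ(\alpha\otimes\mu)$. A $G$-Hom-coalgebra is a triple $(W,\Delta,\beta)$ with $W$ a $\mathbb{K}$-vector space and $\Delta:W\to W\otimes W$, $\beta:W\to W$ linear maps such that $\sum_{\sigma\in G}(-1)^{\epsilon(\sigma)}\Phi_\sigma\circ\mathbf{c}_\beta(\Delta)=0$, where $\mathbf{c}_\beta(\Delta)=(\Delta\otimes\beta)\circ\Delta-(\beta\otimes\Delta)\circ\Delta$.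 $V^\star=\mathrm{Hom}(V,\mathbb{K})$. The transpose $\mu^\star:V^\star\to(V\otimes V)^\star\cong V^\star\otimes V^\star$ uses the canonical isomorphism (valid since $V$ is finite-dimensional): for a basis $e_1,\dots,e_n$ of $V$ with dual basis $e_1^*,\dots,e_n^*$, $\mu^\star(f)=\sum_{i,j}f(\mu(e_i\otimes e_j))\,e_i^*\otimes e_j^*$. Also $\alpha^\star(f)=f\circ\alpha$. *)

(* Defs.v *)
From HB Require Import structures.
From mathcomp Require Import all_boot all_fingroup all_algebra.
From mathcomp Require Import generic_quotient ring_quotient sesquilinear.
From mathcomp Require Import boolp.
From mathcomp.multinomials Require Import freeg.

Set Implicit Arguments.
Unset Strict Implicit.
Unset Printing Implicit Defensive.

Import GRing.Theory.
Import Quotient.Exports.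
Local Open Scope ring_scope.
Local Open Scope quotient_scope.

Section FreeModule.
Context {R : nzRingType} {X : choiceType}.

Lemma fglift_is_linear (M : lmodType R) (f : X -> M) :
  linear (fglift f : {freeg X / R} -> M).
Proof.
have fD : {morph fglift f : x y / x + y >-> x + y}.
  move=> x y; have fB := @lift_is_additive R X M f.
  have f0 : fglift f 0 = 0 by rewrite -[0 in LHS](subrr 0) fB subrr.
  by rewrite -[y in LHS]opprK fB -(sub0r y) fB f0 sub0r opprK.
have f0 : fglift f 0 = 0.
  by apply: (addrI (fglift f 0)); rewrite -fD !addr0.
move=> a x y; rewrite fD; congr (_ + _).
rewrite -[in RHS](freeg_sumE x) -[in LHS](freeg_sumE x).
rewrite scaler_sumr !(big_morph _ fD f0) scaler_sumr.
apply: eq_bigr => z _; rewrite -/(fglift f _) liftU scalerA.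
have -> : a *: [freeg [:: (coeff z x, z)]] = [freeg [:: (a * coeff z x, z)]].
  by apply/eqP/freeg_eqP => t; rewrite coeffZ !coeffU mulrA.
by rewrite liftU.
Qed.

End FreeModule.

Section Tensor.
Context {K : fieldType} (V W : lmodType K).

Local Notation free := {freeg (V * W)%type / K}.
Local Notation "[ v , w ]" := (<< (v, w) >> : free).

(* The subspace of the free vector space on V * W spanned by the
   bilinearity relators. *)
Inductive tensor_rel : free -> Prop :=
| TensorRel0 : tensor_rel 0
| TensorRelD a x y : tensor_rel x -> tensor_rel y -> tensor_rel (a *: x + y)
| TensorRelL a v v' w : tensor_rel ([a *: v + v', w] - (a *: [v, w] + [v', w]))
| TensorRelR a v w w' : tensor_rel ([v, a *: w + w'] - (a *: [v, w] + [v, w'])).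

Definition tensor_ker : {pred free} := fun x => `[< tensor_rel x >].

Lemma tensor_kerZ a x : x \in tensor_ker -> a *: x \in tensor_ker.
Proof.
move=> /asboolP kx; apply/asboolP; rewrite -[_ *: _]addr0.
by apply: TensorRelD => //; apply: TensorRel0.
Qed.

Lemma tensor_ker_zmod_closed : zmod_closed tensor_ker.
Proof.
split; first by apply/asboolP; apply: TensorRel0.
move=> x y /asboolP kx /asboolP ky; apply/asboolP.
by rewrite addrC -scaleN1r; apply: TensorRelD.
Qed.

HB.instance Definition _ :=
  GRing.isZmodClosed.Build free tensor_ker tensor_ker_zmod_closed.

Definition tensor := Quotient.quot tensor_ker.

HB.instance Definition _ : ZmodQuotient _ _ _ _ _ tensor :=
  ZmodQuotient.on tensor.
HB.instance Definition _ := Choice.on tensor.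

Lemma eq_tensorP (x y : free) :
  reflect (\pi_tensor x = \pi_tensor y) (x - y \in tensor_ker).
Proof. by rewrite Quotient.idealrBE; apply: eqP. Qed.

Definition tensor_scale (a : K) (t : tensor) : tensor :=
  \pi_tensor (a *: repr t).

Lemma tensor_scale_pi a (x : free) :
  tensor_scale a (\pi_tensor x) = \pi_tensor (a *: x).
Proof.
apply/eq_tensorP; rewrite -scalerBr tensor_kerZ //.
by apply/eq_tensorP; rewrite reprK.
Qed.

Fact tensor_scaleA a b t :
  tensor_scale a (tensor_scale b t) = tensor_scale (a * b) t.
Proof. by rewrite -[t]reprK !tensor_scale_pi reprK scalerA. Qed.

Fact tensor_scale1 t : tensor_scale 1 t = t.
Proof. by rewrite -{1}[t]reprK tensor_scale_pi scale1r reprK. Qed.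

Fact tensor_scaleDr a t u :
  tensor_scale a (t + u) = tensor_scale a t + tensor_scale a u.
Proof.
by rewrite -[t]reprK -[u]reprK -raddfD !tensor_scale_pi scalerDr raddfD.
Qed.

Fact tensor_scaleDl t a b :
  tensor_scale (a + b) t = tensor_scale a t + tensor_scale b t.
Proof. by rewrite -[t]reprK !tensor_scale_pi scalerDl raddfD. Qed.

HB.instance Definition _ := GRing.Zmodule_isLmodule.Build K tensor
  tensor_scaleA tensor_scale1 tensor_scaleDr tensor_scaleDl.

Lemma tensor_pi_is_linear : linear \pi_tensor.
Proof.
move=> a x y; rewrite raddfD; congr (_ + _).
by rewrite -[RHS]/(tensor_scale a _) tensor_scale_pi.
Qed.

Definition tens (v : V) (w : W) : tensor := \pi_tensor [v, w].

Lemma tens_bilinear : bilinear_for *:%R *:%R tens.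
Proof.
split=> [w a v v' | v a w w']; rewrite -tensor_pi_is_linear;
  by apply/eq_tensorP/asboolP; constructor.
Qed.

Lemma tens_linearl a v v' w :
  tens (a *: v + v') w = a *: tens v w + tens v' w.
Proof. exact: tens_bilinear.1. Qed.

Lemma tens_linearr a v w w' :
  tens v (a *: w + w') = a *: tens v w + tens v w'.
Proof. exact: tens_bilinear.2. Qed.

Lemma tensDl v v' w : tens (v + v') w = tens v w + tens v' w.
Proof. by rewrite -[v in LHS]scale1r tens_linearl scale1r. Qed.

Lemma tensDr v w w' : tens v (w + w') = tens v w + tens v w'.
Proof. by rewrite -[w in LHS]scale1r tens_linearr scale1r. Qed.

Lemma tens0l w : tens 0 w = 0.
Proof. by apply: (addrI (tens 0 w)); rewrite -tensDl !addr0. Qed.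

Lemma tens0r v : tens v 0 = 0.
Proof. by apply: (addrI (tens v 0)); rewrite -tensDr !addr0. Qed.

Lemma tensZl a v w : tens (a *: v) w = a *: tens v w.
Proof. by rewrite -[a *: v]addr0 tens_linearl tens0l addr0. Qed.

Lemma tensZr a v w : tens v (a *: w) = a *: tens v w.
Proof. by rewrite -[a *: w]addr0 tens_linearr tens0r addr0. Qed.

Lemma tens_suml (I : finType) (F : I -> V) w :
  tens (\sum_i F i) w = \sum_i tens (F i) w.
Proof. exact: (big_morph (tens^~ w) (fun v v' => tensDl v v' w) (tens0l w)). Qed.

Lemma tens_sumr (I : finType) v (F : I -> W) :
  tens v (\sum_i F i) = \sum_i tens v (F i).
Proof. exact: (big_morph (tens v) (tensDr v) (tens0r v)). Qed.

HB.instance Definition _ :=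
  @bilinear_isBilinear.Build K V W tensor *:%R *:%R tens tens_bilinear.

(* Meaningful (linear, and determined by its values on pure tensors) when f is
   bilinear. *)
Definition tensor_lift (U : lmodType K) (f : V -> W -> U) (t : tensor) : U :=
  fglift (fun p => f p.1 p.2) (repr t).

Section Lift.
Context (U : lmodType K) (f : V -> W -> U).
Hypothesis f_bilinear : bilinear_for *:%R *:%R f.

Lemma tensor_lift_pi (x : free) :
  tensor_lift f (\pi_tensor x) = fglift (fun p => f p.1 p.2) x.
Proof.
pose F : free -> U := fglift (fun p => f p.1 p.2).
have FL : linear F := fglift_is_linear _.
have FB : {morph F : y z / y - z} by apply: lift_is_additive.
have F1 v w : F [v, w] = f v w by rewrite /F liftU scale1r.
have F0 y : tensor_rel y -> F y = 0.
  elim=> [|a {}y z _ y0 _ z0|a v v' w|a v w w'].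
  - by rewrite -(subrr 0) FB subrr.
  - by rewrite FL y0 z0 scaler0 addr0.
  - by rewrite FB FL !F1 f_bilinear.1 subrr.
  - by rewrite FB FL !F1 f_bilinear.2 subrr.
apply/eqP; rewrite -subr_eq0 /tensor_lift -/F -FB; apply/eqP/F0/asboolP.
by apply/eq_tensorP; rewrite reprK.
Qed.

Lemma tensor_lift_is_linear : linear (tensor_lift f).
Proof.
move=> a t u; rewrite -[t]reprK -[u]reprK -tensor_pi_is_linear.
by rewrite !tensor_lift_pi fglift_is_linear.
Qed.

Lemma tensor_lift_tens v w : tensor_lift f (tens v w) = f v w.
Proof. by rewrite tensor_lift_pi liftU scale1r. Qed.

End Lift.

Lemma tensor_ind (P : tensor -> Prop) :
    P 0 -> (forall a v w t, P t -> P (a *: tens v w + t)) ->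
  forall t, P t.
Proof.
move=> P0 PD t; rewrite -[t]reprK -(freeg_sumE (repr t)).
elim: (dom _) => [|[v w] s IHs]; first by rewrite big_nil raddf0.
rewrite big_cons; set x := (X in X + _).
have -> : x = coeff (v, w) (repr t) *: [v, w].
  by apply/eqP/freeg_eqP => z; rewrite coeffZ !coeffU mul1r.
by rewrite tensor_pi_is_linear; apply: PD.
Qed.

Lemma tensor_ext (U : lmodType K) (f g : tensor -> U) :
    linear f -> linear g -> (forall v w, f (tens v w) = g (tens v w)) ->
  f =1 g.
Proof.
move=> fL gL fg; have z0 (h : tensor -> U) : linear h -> h 0 = 0.
  by move=> /(_ (- 1) 0 0); rewrite scaler0 addr0 scaleN1r addNr.
by apply: tensor_ind => [|a v w t IHt]; rewrite ?z0 // fL gL fg IHt.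
Qed.

End Tensor.

Arguments tensor {K} (V W)%_type_scope.

Notation "V ⊗ W" := (tensor V W) (at level 40, left associativity) : type_scope.
Notation "v ⊗ w" := (tens v w) (at level 40, left associativity) : ring_scope.


Section TensorMap.
Context {K : fieldType}.
Implicit Types U V W : lmodType K.

Section Map.
Context {V V' W W' : lmodType K} (f : {linear V -> V'}) (g : {linear W -> W'}).

Definition tensor_map : V ⊗ W -> V' ⊗ W' :=
  tensor_lift (fun v w => f v ⊗ g w).

Fact tensor_map_bilinear : bilinear_for *:%R *:%R (fun v w => f v ⊗ g w).
Proof.
split=> [w|v] a x y /=; first by rewrite [f _]linearP tens_linearl.
by rewrite [g _]linearP tens_linearr.
Qed.

Fact tensor_map_is_linear : linear tensor_map.
Proof. exact: tensor_lift_is_linear tensor_map_bilinear. Qed.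

HB.instance Definition _ :=
  GRing.isLinear.Build K (V ⊗ W)%type (V' ⊗ W')%type
  *:%R tensor_map tensor_map_is_linear.

Lemma tensor_mapE v w : tensor_map (v ⊗ w) = f v ⊗ g w.
Proof. exact: tensor_lift_tens tensor_map_bilinear v w. Qed.

End Map.

Section Curry.
Context {U V W T : lmodType K} (f : U -> V -> W -> T).

Definition trilinear : Prop :=
  [/\ forall v w, linear (fun u => f u v w),
      forall u w, linear (fun v => f u v w) &
      forall u v, linear (fun w => f u v w)].

Definition tensor_lift3 : U ⊗ V ⊗ W -> T :=
  tensor_lift (fun t w => tensor_lift (fun u v => f u v w) t).

Hypothesis f_trilinear : trilinear.

Let f_bilinear w : bilinear_for *:%R *:%R (fun u v => f u v w).
Proof. by case: f_trilinear => f1 f2 f3; split=> [v|u]; auto. Qed.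

Let lift_bilinear :
  bilinear_for *:%R *:%R (fun t w => tensor_lift (fun u v => f u v w) t).
Proof.
split=> [w|t]; first exact: tensor_lift_is_linear (f_bilinear w).
move=> a w w'; move: t; apply: tensor_ind => [|b u v t IHt].
  have l0 w1 : tensor_lift (fun u v => f u v w1) 0 = 0.
    have /(_ (- 1) 0 0) := tensor_lift_is_linear (f_bilinear w1).
    by rewrite scaler0 addr0 scaleN1r addNr.
  by rewrite !l0 /= scaler0 addr0.
rewrite !(tensor_lift_is_linear (f_bilinear _)) IHt.
rewrite !(tensor_lift_tens (f_bilinear _)).
case: f_trilinear => _ _ f3; rewrite f3 /= !scalerDr !scalerA (mulrC a).
by rewrite addrACA.
Qed.

Lemma tensor_lift3_is_linear : linear tensor_lift3.
Proof. exact: tensor_lift_is_linear lift_bilinear. Qed.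

Lemma tensor_lift3_tens u v w : tensor_lift3 (u ⊗ v ⊗ w) = f u v w.
Proof.
by rewrite /tensor_lift3 (tensor_lift_tens lift_bilinear)
  (tensor_lift_tens (f_bilinear w)).
Qed.

End Curry.

Lemma tensor_ext3 U V W (T : lmodType K) (f g : U ⊗ V ⊗ W -> T) :
    linear f -> linear g ->
    (forall u v w, f (u ⊗ v ⊗ w) = g (u ⊗ v ⊗ w)) ->
  f =1 g.
Proof.
move=> fL gL fg; apply: tensor_ext => // t w; move: t; apply: tensor_ind => [|a u v t IHt].
  have h0 (h : U ⊗ V ⊗ W -> T) : linear h -> h 0 = 0.
    by move=> /(_ (- 1) 0 0); rewrite scaler0 addr0 scaleN1r addNr.
  by rewrite tens0l !h0.
by rewrite tens_linearl fL gL fg IHt.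
Qed.

Section Assoc.
Context {U V W : lmodType K}.

Definition tensor_assocr : U ⊗ V ⊗ W -> U ⊗ (V ⊗ W) :=
  tensor_lift3 (fun u v w => u ⊗ (v ⊗ w)).

Definition tensor_assocl : U ⊗ (V ⊗ W) -> U ⊗ V ⊗ W :=
  tensor_lift (fun u => tensor_lift (fun v w => u ⊗ v ⊗ w)).

Fact tensor_assocr_trilinear :
  trilinear (fun (u : U) (v : V) (w : W) => u ⊗ (v ⊗ w)).
Proof.
by split=> [v w|u w|u v] a x y;
  rewrite ?tens_linearl ?tens_linearr // ?tens_linearr.
Qed.

Fact tensor_assocr_is_linear : linear tensor_assocr.
Proof. exact: tensor_lift3_is_linear tensor_assocr_trilinear. Qed.

HB.instance Definition _ :=
  GRing.isLinear.Build K (U ⊗ V ⊗ W)%type (U ⊗ (V ⊗ W))%type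
  *:%R tensor_assocr tensor_assocr_is_linear.

Lemma tensor_assocrE u v w : tensor_assocr (u ⊗ v ⊗ w) = u ⊗ (v ⊗ w).
Proof. exact: tensor_lift3_tens tensor_assocr_trilinear u v w. Qed.

Let assocl_bilinear2 u :
  bilinear_for *:%R *:%R (fun (v : V) (w : W) => (u : U) ⊗ v ⊗ w).
Proof.
split=> [w|v] a x y; last by rewrite tens_linearr.
by rewrite [u ⊗ _]tens_linearr tens_linearl.
Qed.

Let assocl_bilinear : bilinear_for *:%R *:%R
  (fun (u : U) => tensor_lift (fun (v : V) (w : W) => u ⊗ v ⊗ w)).
Proof.
split=> [t|u]; last exact: tensor_lift_is_linear (assocl_bilinear2 u).
move=> a u u'; move: t; apply: tensor_ind => [|b v w t IHt].
  have l0 u1 : tensor_lift (fun (v : V) (w : W) => (u1 : U) ⊗ v ⊗ w) 0 = 0.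
    have /(_ (- 1) 0 0) := tensor_lift_is_linear (assocl_bilinear2 u1).
    by rewrite scaler0 addr0 scaleN1r addNr.
  by rewrite !l0 /= scaler0 addr0.
rewrite !(tensor_lift_is_linear (assocl_bilinear2 _)) IHt.
rewrite !(tensor_lift_tens (assocl_bilinear2 _)) !tens_linearl.
by rewrite /= !scalerDr !scalerA (mulrC a) addrACA.
Qed.

Fact tensor_assocl_is_linear : linear tensor_assocl.
Proof. exact: tensor_lift_is_linear assocl_bilinear. Qed.

HB.instance Definition _ :=
  GRing.isLinear.Build K (U ⊗ (V ⊗ W))%type (U ⊗ V ⊗ W)%type
  *:%R tensor_assocl tensor_assocl_is_linear.

Lemma tensor_assoclE u v w : tensor_assocl (u ⊗ (v ⊗ w)) = u ⊗ v ⊗ w.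
Proof.
by rewrite /tensor_assocl (tensor_lift_tens assocl_bilinear)
  (tensor_lift_tens (assocl_bilinear2 u)).
Qed.

End Assoc.

End TensorMap.

Section TensorPerm.
Context {K : fieldType} {W : lmodType K}.

Definition tens3 (x : 'I_3 -> W) : W ⊗ W ⊗ W :=
  x 0 ⊗ x 1 ⊗ x 2%:R.

(* x_1 ⊗ x_2 ⊗ x_3 is sent to
   x_(s^-1 1) ⊗ x_(s^-1 2) ⊗ x_(s^-1 3), see tensor_permE; the three slots
   are numbered from 0. *)
Definition tensor_perm (s : 'S_3) : W ⊗ W ⊗ W -> W ⊗ W ⊗ W :=
  tensor_lift3 (fun x y z =>
    tens3 (fun i => tnth [tuple x; y; z] ((s^-1)%g i))).

Fact tensor_perm_trilinear (s : 'S_3) :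
  trilinear (fun x y z => tens3 (fun i => tnth [tuple x; y; z] ((s^-1)%g i))).
Proof.
have t1 u v w w' a : (u : W) ⊗ (v : W) ⊗ (a *: (w : W) + w') =
    a *: (u ⊗ v ⊗ w) + u ⊗ v ⊗ w' by rewrite tens_linearr.
have t2 u v w v' a : (u : W) ⊗ (a *: (v : W) + v') ⊗ (w : W) =
    a *: (u ⊗ v ⊗ w) + u ⊗ v' ⊗ w.
  by rewrite [u ⊗ _]tens_linearr tens_linearl.
have t3 u v w u' a : (a *: (u : W) + u') ⊗ (v : W) ⊗ (w : W) =
    a *: (u ⊗ v ⊗ w) + u' ⊗ v ⊗ w.
  by rewrite [_ ⊗ v]tens_linearl tens_linearl.
rewrite /tens3; set p := (s^-1)%g.
have /negPf n01 : p 0 != p 1 by rewrite (inj_eq perm_inj).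
have /negPf n02 : p 0 != p 2%:R by rewrite (inj_eq perm_inj).
have /negPf n12 : p 1 != p 2%:R by rewrite (inj_eq perm_inj).
move: (p 0) (p 1) (p 2%:R) n01 n02 n12.
move=> [[|[|[|//]]] ?] [[|[|[|//]]] ?] [[|[|[|//]]] ?] //= _ _ _;
  by split=> [v w|u w|u v] a x y; rewrite !(tnth_nth 0) /= ?t1 ?t2 ?t3.
Qed.

Fact tensor_perm_is_linear s : linear (tensor_perm s).
Proof. exact: tensor_lift3_is_linear (tensor_perm_trilinear s). Qed.

HB.instance Definition _ s :=
  GRing.isLinear.Build K (W ⊗ W ⊗ W)%type (W ⊗ W ⊗ W)%type
  *:%R (tensor_perm s) (tensor_perm_is_linear s).

Lemma tensor_permE (s : 'S_3) (x : 'I_3 -> W) :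
  tensor_perm s (tens3 x) = tens3 (fun i => x ((s^-1)%g i)).
Proof.
have xE i : tnth [tuple x 0; x 1; x 2%:R] i = x i.
  case: i => [[|[|[|//]]] lti]; rewrite (tnth_nth 0) /=;
    by congr x; apply: val_inj.
rewrite /tensor_perm {1}/tens3 (tensor_lift3_tens (tensor_perm_trilinear s)).
by rewrite /tens3 !xE.
Qed.

End TensorPerm.

Section GHom.
Context {K : fieldType}.

(* The triple tensor power is (V ⊗ V) ⊗ V throughout; the associativity
   isomorphisms are written explicitly. *)
Definition hom_associator {V : lmodType K} (mu : {linear (V ⊗ V)%type -> V})
    (alpha : {linear V -> V}) (t : V ⊗ V ⊗ V) : V :=
  mu (tensor_map mu alpha t) - mu (tensor_map alpha mu (tensor_assocr t)).

Definition GHom_associative (G : {group 'S_3}) {V : lmodType K}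
    (mu : {linear (V ⊗ V)%type -> V}) (alpha : {linear V -> V}) : Prop :=
  forall t : V ⊗ V ⊗ V,
    \sum_(s in G) (-1) ^+ odd_perm s *:
      hom_associator mu alpha (tensor_perm s t) = 0.

Definition hom_coassociator {W : lmodType K} (Delta : {linear W -> (W ⊗ W)%type})
    (beta : {linear W -> W}) (w : W) : W ⊗ W ⊗ W :=
  tensor_map Delta beta (Delta w) -
  tensor_assocl (tensor_map beta Delta (Delta w)).

Definition GHom_coalgebra (G : {group 'S_3}) {W : lmodType K}
    (Delta : {linear W -> (W ⊗ W)%type}) (beta : {linear W -> W}) : Prop :=
  forall w : W,
    \sum_(s in G) (-1) ^+ odd_perm s *:
      tensor_perm s (hom_coassociator Delta beta w) = 0.

End GHom.

Section Dual.
Context {K : fieldType} {V : vectType K}.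
Local Notation dualV := ('Hom(V, K^o)).

Definition transpose (alpha : {linear V -> V}) (f : dualV) : dualV :=
  linfun (f \o alpha).

Lemma transposeE alpha f v : transpose alpha f v = f (alpha v).
Proof. by rewrite lfunE. Qed.

Fact transpose_is_linear alpha : linear (transpose alpha).
Proof.
by move=> a f g; apply/lfunP => v; rewrite !(transposeE, add_lfunE, scale_lfunE).
Qed.

HB.instance Definition _ alpha := GRing.isLinear.Build K dualV dualV *:%R
  (transpose alpha) (transpose_is_linear alpha).

Definition dual_coord n (e : n.-tuple V) (i : 'I_n) : dualV :=
  linfun (coord e i : V -> K^o).

Lemma dual_coordE n (e : n.-tuple V) i v : dual_coord e i v = coord e i v.
Proof. exact: (@lfunE K V K^o (coord e i) v). Qed.

(* The transpose of mu followed by the inverse of the canonical isomorphism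
   from V^* ⊗ V^* to (V ⊗ V)^*, in coordinates; see transpose_mulE and
   transpose_mul_basis. *)
Definition transpose_mul_in n (e : n.-tuple V) (mu : {linear (V ⊗ V)%type -> V})
    (f : dualV) : dualV ⊗ dualV :=
  \sum_(i < n) \sum_(j < n)
    (f (mu (e`_i ⊗ e`_j)) : K) *: (dual_coord e i ⊗ dual_coord e j).

Definition transpose_mul (mu : {linear (V ⊗ V)%type -> V}) : dualV -> dualV ⊗ dualV :=
  transpose_mul_in (vbasis fullv) mu.

Fact transpose_mul_is_linear mu : linear (transpose_mul mu).
Proof.
move=> a f g; rewrite scaler_sumr -big_split; apply: eq_bigr => i _ /=.
rewrite scaler_sumr -big_split; apply: eq_bigr => j _ /=.
by rewrite add_lfunE scale_lfunE scalerDl scalerA.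
Qed.

HB.instance Definition _ mu := GRing.isLinear.Build K dualV (dualV ⊗ dualV)%type
  *:%R (transpose_mul mu) (transpose_mul_is_linear mu).

(* The canonical map from V^* ⊗ V^* to the dual of V ⊗ V, evaluated at v ⊗ w. *)
Definition dual_pair (v w : V) : dualV ⊗ dualV -> K^o :=
  tensor_lift (fun f g : dualV => (f v * g w : K^o)).

Fact dual_pair_bilinear (v w : V) :
  bilinear_for *:%R *:%R (fun f g : dualV => (f v * g w : K^o)).
Proof.
split=> [g|g] a f f' /=; rewrite add_lfunE scale_lfunE.
  by rewrite mulrDl -mulrA.
by rewrite mulrDr mulrCA.
Qed.

Fact dual_pair_is_linear v w : linear (dual_pair v w).
Proof. exact: tensor_lift_is_linear (dual_pair_bilinear v w). Qed.

HB.instance Definition _ v w := GRing.isLinear.Build K (dualV ⊗ dualV)%type K^o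
  *:%R (dual_pair v w) (dual_pair_is_linear v w).

Lemma dual_pairE v w f g : dual_pair v w (f ⊗ g) = f v * g w.
Proof. exact: tensor_lift_tens (dual_pair_bilinear v w) f g. Qed.

Section Basis.
Context n (e : n.-tuple V) (e_basis : basis_of fullv e).

Lemma dual_decomp (f : dualV) :
  f = \sum_(i < n) (f e`_i : K) *: dual_coord e i.
Proof.
apply/lfunP => v; rewrite sum_lfunE {1}(coord_basis e_basis (memvf v)).
rewrite linear_sum; apply: eq_bigr => i _.
by rewrite linearZ scale_lfunE dual_coordE [RHS]mulrC.
Qed.

Lemma dual_tensor_decomp (t : dualV ⊗ dualV) :
  t = \sum_(i < n) \sum_(j < n)
    (dual_pair e`_i e`_j t : K) *: (dual_coord e i ⊗ dual_coord e j).
Proof.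
move: t; apply: (@tensor_ext K _ _ _ id) => [//|a t u|f g].
  rewrite scaler_sumr -big_split; apply: eq_bigr => i _ /=.
  rewrite scaler_sumr -big_split; apply: eq_bigr => j _ /=.
  by rewrite dual_pair_is_linear scalerDl scalerA.
rewrite {1}(dual_decomp f) {1}(dual_decomp g).
rewrite tens_suml.
apply: eq_bigr => i _; rewrite tens_sumr.
by apply: eq_bigr => j _; rewrite tensZl tensZr scalerA dual_pairE.
Qed.

End Basis.

Lemma dual_pair_inj (t u : dualV ⊗ dualV) :
  (forall v w, dual_pair v w t = dual_pair v w u) -> t = u.
Proof.
move=> tu; have bV := vbasisP (@fullv K V).
rewrite (dual_tensor_decomp bV t) (dual_tensor_decomp bV u).
by apply: eq_bigr => i _; apply: eq_bigr => j _; rewrite tu.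
Qed.

Lemma transpose_mul_inE n (e : n.-tuple V) (mu : {linear (V ⊗ V)%type -> V}) f v w :
  basis_of fullv e -> dual_pair v w (transpose_mul_in e mu f) = f (mu (v ⊗ w)).
Proof.
move=> e_basis; rewrite linear_sum.
transitivity (\sum_(i < n) \sum_(j < n)
    coord e i v * coord e j w * f (mu (e`_i ⊗ e`_j)) : K).
  apply: eq_bigr => i _; rewrite linear_sum; apply: eq_bigr => j _.
  rewrite linearZ /= dual_pairE !dual_coordE; exact: mulrC.
rewrite [in RHS](coord_basis e_basis (memvf v)).
rewrite [in RHS](coord_basis e_basis (memvf w)).
rewrite tens_suml !linear_sum; apply: eq_bigr => i _.
rewrite tens_sumr !linear_sum; apply: eq_bigr => j _.
by rewrite tensZl tensZr !linearZ /= scalerA.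
Qed.

(* transpose_mul mu f is the element of V^* ⊗ V^* that the canonical
   isomorphism sends to the linear form f o mu on V ⊗ V. *)
Lemma transpose_mulE mu f v w :
  dual_pair v w (transpose_mul mu f) = f (mu (v ⊗ w)).
Proof. exact/transpose_mul_inE/vbasisP. Qed.

(* The choice of the basis is immaterial. *)
Lemma transpose_mul_basis n (e : n.-tuple V) mu :
  basis_of fullv e -> transpose_mul mu =1 transpose_mul_in e mu.
Proof.
move=> e_basis f; apply: dual_pair_inj => v w.
by rewrite transpose_mulE transpose_mul_inE.
Qed.

End Dual.

(* Main.v *)
Require Import Defs.
From HB Require Import structures.
From mathcomp Require Import all_boot all_fingroup all_algebra.
Import GRing.Theory.
Local Open Scope ring_scope.

(** Evaluation at three vectors [x 0], [x 1], [x 2] is a linear form on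
    [V^* ⊗ V^* ⊗ V^*], and these forms jointly separate points because [V] is
    finite-dimensional ([dual_pair3_inj]).  So the coalgebra identity can be
    tested against every triple [x].  Under this pairing,

    - the coassociator of [mu^*] and [alpha^*] at [f] becomes [f] composed with
      the associator of [mu] and [alpha] ([dual_pair3_coassociator]);
    - permuting the tensor factors of [V^*] by [s] is adjoint to permuting those
      of [V] by [s^-1] ([dual_pair3_perm]).

    Hence the alternating sum over [G] that defines a coalgebra evaluates at [x]
    to [f] applied to the sum that defines an algebra, indexed by inverses; as
    [G] is closed under inversion and [s], [s^-1] have the same signature, the
    two sums agree, and the latter is zero. *)

Section DualPair3.
Context {K : fieldType} {V : vectType K}.
Local Notation dualV := ('Hom(V, K^o)).
Implicit Types (x : 'I_3 -> V) (f : dualV) (s : 'S_3).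

(** The canonical map from the triple tensor power of [V^*] to the trilinear
    forms on [V], evaluated at [x].  The triple is a function on ['I_3] so that
    permutations act on it by precomposition. *)
Definition dual_pair3 x : dualV ⊗ dualV ⊗ dualV -> K^o :=
  tensor_lift (fun t (h : dualV) => (dual_pair (x 0) (x 1) t * h (x 2%:R) : K^o)).

Fact dual_pair3_bilinear x : bilinear_for *:%R *:%R
  (fun t (h : dualV) => (dual_pair (x 0) (x 1) t * h (x 2%:R) : K^o)).
Proof.
split=> [h|t] a u v /=; first by rewrite linearP /= mulrDl -mulrA.
by rewrite add_lfunE scale_lfunE mulrDr mulrCA.
Qed.

Fact dual_pair3_is_linear x : linear (dual_pair3 x).
Proof. exact: tensor_lift_is_linear (dual_pair3_bilinear x). Qed.

HB.instance Definition _ x := GRing.isLinear.Build K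
  (dualV ⊗ dualV ⊗ dualV)%type K^o *:%R (dual_pair3 x) (dual_pair3_is_linear x).

Lemma dual_pair3_tens x t f :
  dual_pair3 x (t ⊗ f) = dual_pair (x 0) (x 1) t * f (x 2%:R).
Proof. exact: tensor_lift_tens (dual_pair3_bilinear x) t f. Qed.

Lemma dual_pair3E x (phi : 'I_3 -> dualV) :
  dual_pair3 x (tens3 phi) = \prod_i phi i (x i).
Proof.
rewrite dual_pair3_tens dual_pairE !big_ord_recl big_ord0 mulr1 mulrA.
by congr (_ * phi _ (x _) * phi _ (x _)); apply: val_inj.
Qed.

(** The triple tensors of the dual basis span, and the coordinates of a tensor
    along them are its values at triples of basis vectors.  Hence the values
    determine the tensor. *)
Lemma dual_pair3_decomp n (e : n.-tuple V) (T : dualV ⊗ dualV ⊗ dualV) :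
  basis_of fullv e ->
  T = \sum_(i < n) \sum_(j < n) \sum_(k < n)
    (dual_pair3 (tnth [tuple e`_i; e`_j; e`_k]) T : K) *:
      (dual_coord e i ⊗ dual_coord e j ⊗ dual_coord e k).
Proof.
move=> e_basis; move: T; apply: (@tensor_ext K _ _ _ id) => [//|a T U|t h].
  do 3 (rewrite scaler_sumr -big_split; apply: eq_bigr => ? _ /=).
  by rewrite dual_pair3_is_linear scalerDl scalerA.
rewrite /= {1}(dual_tensor_decomp e_basis t) tens_suml.
apply: eq_bigr => i _; rewrite tens_suml; apply: eq_bigr => j _.
rewrite {1}(dual_decomp e_basis h) tens_sumr; apply: eq_bigr => k _.
by rewrite tensZl tensZr scalerA dual_pair3_tens !(tnth_nth 0).
Qed.

Lemma dual_pair3_inj (T U : dualV ⊗ dualV ⊗ dualV) :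
  (forall x, dual_pair3 x T = dual_pair3 x U) -> T = U.
Proof.
move=> TU; have bV := vbasisP (@fullv K V).
rewrite (dual_pair3_decomp _ _ T bV) (dual_pair3_decomp _ _ U bV).
by do 3 (apply: eq_bigr => ? _); rewrite TU.
Qed.

(** On a pure tensor both sides are the product of the scalars
    [phi i (x (s i))], indexed by the factors on one side and by the vectors
    on the other. *)
Lemma dual_pair3_perm x s T :
  dual_pair3 x (tensor_perm s T) = dual_pair3 (x \o s) T.
Proof.
move: T; apply: tensor_ext3 => [a T U|a T U|u v w]; rewrite ?linearP //.
have -> : u ⊗ v ⊗ w = tens3 (tnth [tuple u; v; w]) by [].
rewrite tensor_permE !dual_pair3E (reindex_inj (@perm_inj _ s)) /=.
by apply: eq_bigr => i _; rewrite permK.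
Qed.

Lemma tensor_permV_tens3 x s :
  tensor_perm (s^-1)%g (tens3 x) = tens3 (x \o s).
Proof. by rewrite tensor_permE invgK. Qed.

Section Transpose.
Variables (mu : {linear (V ⊗ V)%type -> V}) (alpha : {linear V -> V}).

(** Both transposes are adjoint to the original maps under the pairings, so each
    half of the coassociator can be moved to the side of the vectors.  It is
    enough to see this on pure tensors [f ⊗ g], which leaves an arbitrary
    element [transpose_mul mu f] as one factor. *)
Lemma dual_pair3_mapl x t :
  dual_pair3 x (tensor_map (transpose_mul mu) (transpose alpha) t) =
  dual_pair (mu (x 0 ⊗ x 1)) (alpha (x 2%:R)) t.
Proof.
move: t; apply: tensor_ext => [a t u|a t u|f g]; rewrite ?linearP //.
by rewrite tensor_mapE dual_pair3_tens transpose_mulE transposeE dual_pairE.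
Qed.

Lemma dual_pair3_assocl x f t :
  dual_pair3 x (tensor_assocl (f ⊗ t)) = f (x 0) * dual_pair (x 1) (x 2%:R) t.
Proof.
move: t; apply: tensor_ext => [a t u|a t u|g h].
- by rewrite tens_linearr !linearP.
- by rewrite linearP /= mulrDr mulrCA.
- by rewrite tensor_assoclE dual_pair3_tens !dual_pairE mulrA.
Qed.

Lemma dual_pair3_mapr x t :
  dual_pair3 x
    (tensor_assocl (tensor_map (transpose alpha) (transpose_mul mu) t)) =
  dual_pair (alpha (x 0)) (mu (x 1 ⊗ x 2%:R)) t.
Proof.
move: t; apply: tensor_ext => [a t u|a t u|f g]; rewrite ?linearP //.
by rewrite tensor_mapE dual_pair3_assocl transpose_mulE transposeE dual_pairE.
Qed.

Lemma dual_pair3_coassociator x f :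
  dual_pair3 x (hom_coassociator (transpose_mul mu) (transpose alpha) f) =
  f (hom_associator mu alpha (tens3 x)).
Proof.
rewrite /hom_coassociator /hom_associator !linearB /=; congr (_ - _).
  by rewrite dual_pair3_mapl transpose_mulE tensor_mapE.
by rewrite dual_pair3_mapr transpose_mulE tensor_assocrE tensor_mapE.
Qed.

End Transpose.
End DualPair3.

Theorem proposition2p12 (K : closedFieldType) (charK : [pchar K] =i pred0)
    (G : {group 'S_3}) (V : vectType K)
    (mu : {linear (V ⊗ V)%type -> V}) (alpha : {linear V -> V}) :
  GHom_associative G mu alpha ->
  GHom_coalgebra G (transpose_mul mu) (transpose alpha).
Proof.
move=> assocG f; apply: dual_pair3_inj => x.
rewrite linear0 -[RHS](linear0 f) -(assocG (tens3 x)) !linear_sum /=.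
(* The adjoint of the permutation by [s] is the one by [s^-1], so the sum on
   the algebra side has to run over the inverses. *)
rewrite [RHS](reindex_inj invg_inj) /=.
apply: eq_big => [s|s _]; first by rewrite groupV.
rewrite !linearZ /= dual_pair3_perm dual_pair3_coassociator.
by rewrite odd_permV tensor_permV_tens3.
Qed.
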